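(* Let $X_1,\dots,X_n$ be independent $\mathrm{Poi}(1)$ random variables, and let $P_n^{\mathrm{Poi}}$ be the path $v_1v_2\cdots v_n$ with initial weight $w(v_i)=X_i$; let $A_t(P_n^{\mathrm{Poi}})$ be its total acquisition number. Then for any function $\phi$ with $\phi(n)\to\infty$, $$\Pr\Big[\big|A_t(P_n^{\mathrm{Poi}}) - E\big(A_t(P_n^{\mathrm{Poi}})\big)\big| > \sqrt{2n\phi(n)}\Big] \to 0 \quad (n\to\infty),$$ and $E\big(A_t(P_n^{\mathrm{Poi}})\big)=\Theta(n)$; thus $A_t(P_n^{\mathrm{Poi}})$ is concentrated in an interval of width $O(\sqrt{n\phi(n)})$ around its mean.
   Context: Let $G$ be a graph whose vertices carry nonnegative integer weights $w(v)$. An acquisition move consists of choosing adjacent vertices $u,v$ with current weights satisfying $w(u)\ge w(v)>0$ and transferring all of the weight of $v$ to $u$. A sequence of acquisition moves after which no further move is possible is an acquisition protocol; the set of vertices with nonzero weight at its end is the residual set. The total acquisition number $a_t(G)$ is the minimum size of a residual set over all acquisition protocols. *)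

(* Defs.v *)
From HB Require Import structures.
From mathcomp Require Import all_boot all_order all_algebra.
From mathcomp Require Import all_classical all_reals all_analysis.

Set Implicit Arguments.
Unset Strict Implicit.
Unset Printing Implicit Defensive.

Import Order.TTheory GRing.Theory Num.Theory.
Import numFieldNormedType.Exports.

Local Open Scope classical_set_scope.

Structure sgraph := SGraph {
  vertex :> finType;
  adj : rel vertex;
  adj_sym : symmetric adj;
  adj_irrefl : irreflexive adj }.

Section Acquisition.
Variable G : sgraph.
Implicit Types (w : {ffun G -> nat}) (u v x : G).

Definition can_acquire w u v : bool :=
  [&& adj u v, 0 < w v & w v <= w u]%N.

Definition acquire w u v : {ffun G -> nat} :=
  [ffun x => if x == u then (w u + w v)%N else if x == v then 0%N else w x].

Definition acq_move : rel {ffun G -> nat} :=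
  fun w w' => [exists u, exists v, can_acquire w u v && (w' == acquire w u v)].

Definition acq_final w : bool := [forall u, forall v, ~~ can_acquire w u v].

(* A protocol is recorded by the successive weightings it goes through after *)
(* the initial one.                                                          *)
Definition acq_protocol w (s : seq {ffun G -> nat}) : bool :=
  path acq_move w s && acq_final (last w s).

Definition residual w : {set G} := [set v | (0 < w v)%N]%SET.

Definition residual_size w (k : nat) : Prop :=
  exists s, acq_protocol w s /\ #|residual (last w s)| = k.

Lemma residual_acquire w u v :
  can_acquire w u v -> residual (acquire w u v) \proper residual w.
Proof.
case/and3P=> uv v0 vu; have vNu : v != u.
  by apply: contraTneq uv => ->; rewrite adj_irrefl.
apply/properP; split.
  apply/fintype.subsetP => x; rewrite !inE ffunE; case: eqP => [->|_].
    by move=> _; apply: leq_trans vu.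
  by case: eqP.
by exists v; rewrite inE ?v0// ffunE (negPf vNu) eqxx.
Qed.

Lemma residual_size_exists w : exists k, `[< residual_size w k >].
Proof.
suff [s ps] : exists s, acq_protocol w s.
  by exists #|residual (last w s)|; apply/asboolP; exists s.
have [m] := ubnP #|residual w|; elim: m w => // m IHm w wm.
have [wf|] := boolP (acq_final w); first by exists [::]; rewrite /acq_protocol.
rewrite negb_forall => /existsP[u]; rewrite negb_forall => /existsP[v].
rewrite negbK => wuv.
have /IHm[s /andP[ps fs]] : (#|residual (acquire w u v)| < m)%N.
  exact: leq_trans (proper_card (residual_acquire wuv)) _.
exists (acquire w u v :: s); rewrite /acq_protocol /= ps fs !andbT.
by apply/existsP; exists u; apply/existsP; exists v; rewrite wuv eqxx.
Qed.

Definition total_acquisition w : nat := ex_minn (residual_size_exists w).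

End Acquisition.

Section PathGraph.
Variable n : nat.

Definition path_adj : rel 'I_n :=
  fun i j => (i.+1 == j :> nat) || (j.+1 == i :> nat).

Lemma path_adj_sym : symmetric path_adj.
Proof. by move=> i j; rewrite /path_adj orbC. Qed.

Lemma path_adj_irrefl : irreflexive path_adj.
Proof. by move=> i; rewrite /path_adj orbb eqn_leq ltnn. Qed.

Definition path_graph : sgraph := SGraph path_adj_sym path_adj_irrefl.

End PathGraph.

Section RandomWeights.
Context {R : realType} {d : measure_display} {T : measurableType d}.
Variable P : probability T R.

Definition mutually_independent {d' : measure_display}
    {T' : measurableType d'} (I : finType) (X : I -> {RV P >-> T'}) : Prop :=
  forall (J : {set I}) (B : I -> set T'),
    (forall i, measurable (B i)) ->
    P (\bigcap_(i in [set` J]) X i @^-1` B i) =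
    (\prod_(i in J) P (X i @^-1` B i))%E.

Definition poisson_distributed (rate : R) (X : {RV P >-> nat}) : Prop :=
  forall k : nat, P (X @^-1` [set k]) = (poisson_pmf rate k)%:E.

Definition path_acquisition (n : nat) (X : 'I_n -> {RV P >-> nat}) : T -> R :=
  fun t => (total_acquisition ([ffun i => X i t] : {ffun path_graph n -> nat}))%:R%R.

End RandomWeights.

(* Main.v *)
(* On a graph of maximum degree 2, changing the weight of a single vertex changes
   the total acquisition number by at most 5: an optimal protocol for one weighting
   can be replayed from the other one, skipping a bounded number of moves.  For
   independent weights, averaging the coordinates out one at a time shows that such
   a Lipschitz function of n coordinates has variance at most 25 n, so Chebyshev's
   inequality already gives concentration at scale sqrt (n phi(n)).  The mean is at
   most n, and at least n e^-3 because a vertex of weight 1 whose neighbours all have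
   weight 0 is never involved in a move. *)

Require Import Defs.
From HB Require Import structures.
From mathcomp Require Import all_boot all_order all_algebra.
From mathcomp Require Import all_classical all_reals all_analysis.
From mathcomp Require Import measurable_realfun ring lra.

Set Implicit Arguments.
Unset Strict Implicit.
Unset Printing Implicit Defensive.

Import Order.TTheory GRing.Theory Num.Theory.
Import numFieldNormedType.Exports.

Local Open Scope classical_set_scope.
Local Open Scope ring_scope.

(** * Acquisition moves *)

Section AcquisitionMoves.
Local Open Scope nat_scope.
Variable G : sgraph.
Implicit Types (w z : {ffun G -> nat}) (u v x c : G) (D : {set G}).

Lemma acq_moveP w w' :
  reflect (exists u v, can_acquire w u v /\ w' = acquire w u v) (acq_move w w').
Proof.
apply: (iffP existsP) => [[u /existsP[v /andP[uv /eqP->]]]|[u [v [uv ->]]]].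
  by exists u, v.
by exists u; apply/existsP; exists v; rewrite uv eqxx.
Qed.

Lemma can_acquire_neq w u v : can_acquire w u v -> v != u.
Proof. by case/and3P=> uv _ _; apply: contraTneq uv => ->; rewrite adj_irrefl. Qed.

Lemma leq_residual_path w s :
  path (@acq_move G) w s -> #|residual (last w s)| <= #|residual w|.
Proof.
elim: s w => //= w' s IHs w /andP[/acq_moveP[u [v [uv ->]]] /IHs].
by move/leq_trans; apply; apply/subset_leq_card/proper_sub/residual_acquire.
Qed.

Lemma total_acquisition_attained w :
  exists s, acq_protocol w s /\ #|residual (last w s)| = total_acquisition w.
Proof. by rewrite /total_acquisition; case: ex_minnP => k /asboolP. Qed.

(** A replayed run need not end in a final weighting: any sequence of moves extends to a protocol,
    and further moves never enlarge the residual set. *)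
Lemma total_acquisition_le_path w s : path (@acq_move G) w s ->
  total_acquisition w <= #|residual (last w s)|.
Proof.
move=> ws; have [s' [/andP[ws' fs'] _]] := total_acquisition_attained (last w s).
apply: leq_trans (leq_residual_path ws').
rewrite /total_acquisition; case: ex_minnP => k _; apply; apply/asboolP.
by exists (s ++ s'); rewrite /acq_protocol cat_path last_cat ws ws'.
Qed.

Lemma total_acquisition_le_card w : total_acquisition w <= #|G|.
Proof.
by apply: leq_trans (total_acquisition_le_path (s := [::]) _) (max_card _).
Qed.

(** * Isolated vertices and a lower bound on the acquisition number *)

Definition isolated w u : bool := (0 < w u) && [forall v, adj u v ==> (w v == 0)].

(** A move joins two adjacent vertices of positive weight, so it involves neither an isolated vertex
    nor any of its neighbours. *)
Lemma isolated_acq_move w w' u : acq_move w w' -> isolated w u -> isolated w' u.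
Proof.
case/acq_moveP=> a [b [/and3P[ab b0 ba] ->]] /andP[u0 /forallP uN].
have zN x : adj u x -> w x = 0 by move=> ux; apply/eqP; apply: implyP (uN x) ux.
have a0 : 0 < w a by exact: leq_trans ba.
have ua : u != a by apply: contraTneq b0 => ua; rewrite zN// ua.
have ub : u != b by apply: contraTneq a0 => ub; rewrite zN// ub adj_sym.
rewrite /isolated ffunE (negPf ua) (negPf ub) u0; apply/forallP => x.
apply/implyP => ux; rewrite ffunE; case: (eqVneq x a) => [xa|_].
  by move: a0; rewrite -xa zN.
by rewrite zN// if_same.
Qed.

Lemma isolated_le_total_acquisition w :
  #|[set u | isolated w u]%SET| <= total_acquisition w.
Proof.
have [s [/andP[ws _] <-]] := total_acquisition_attained w.
apply: subset_leq_card; apply/fintype.subsetP => u; rewrite !inE.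
elim: s w ws => [|w' s IHs] w /=; first by move=> _ /andP[].
by move=> /andP[ww' ws] /(isolated_acq_move ww'); exact: IHs.
Qed.

(** * Lipschitz dependence on a single weight *)

Definition live_nbrs w u : {set G} := [set x | adj u x && (0 < w x)]%SET.

Hypothesis deg2 : forall u, #|[set v | adj u v]%SET| <= 2.

(* A protocol from [z] is replayed from [z0]; the two runs differ only at one
   vertex [c], and at the set [D] of vertices left behind by skipped moves.
   A skipped move of [c] uses up a live neighbour of [c]; when [u] acquires [c],
   the roles pass to [u], which has at most one neighbour besides the dead [c].
   So the sum of [#|D|] and the number of live neighbours of [c] never grows. *)
Lemma acq_replay s z z0 c D : path (@acq_move G) z s ->
  (forall x, x \notin D -> x != c -> z0 x = z x) ->
  (c \notin D -> z0 c <= z c) -> (forall x, x \in D -> z x = 0) ->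
  exists2 s0, path (@acq_move G) z0 s0 &
    #|residual (last z0 s0)| <=
      #|residual (last z s)| + (#|D| + #|live_nbrs z c|).
Proof.
elim: s z z0 c D => [|z' s IHs] z z0 c D /=.
  (* With no move left, only vertices of [D] can be residual for [z0] without being residual for
     [z]. *)
  move=> _ zE zc zD; exists [::] => //=; rewrite addnA.
  apply: leq_trans (leq_addr _ _); apply: leq_trans (leq_card_setU _ _).
  apply: subset_leq_card; apply/fintype.subsetP => x; rewrite !inE.
  have [//|xD] := boolP (x \in D); first by rewrite orbT.
  rewrite orbF; have [xc|xc] := eqVneq x c; last by rewrite zE.
  by rewrite xc => /leq_trans; apply; apply: zc; rewrite -xc.
move=> /andP[/acq_moveP[u [v [zuv ->]]] zs] zE zc zD.
have vNu := can_acquire_neq zuv; have /and3P[uv v0 vu] := zuv.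
have u0 : 0 < z u by exact: leq_trans vu.
have live_notin x : 0 < z x -> x \notin D.
  by move=> x0; apply: contraTN x0 => /zD->.
have zD' x : x \in D -> acquire z u v x = 0.
  move=> xD; rewrite ffunE; case: eqP => [xu|_]; last by case: eqP => // _; exact: zD.
  by move: (live_notin u u0); rewrite -xu xD.
(* When [c] acquires [v], the move is skipped: [v] keeps its weight in the replay and enters [D],
   but it ceases to be a live neighbour of [c]. *)
have [uc|uc] := eqVneq u c.
  have [||x|s0 z0s0 le_s0] := IHs _ z0 c (v |: D) zs.
  - move=> x; rewrite !inE negb_or => /andP[xv xD] xc.
    by rewrite ffunE uc (negPf xc) (negPf xv) zE.
  - rewrite !inE negb_or => /andP[_ cD].
    by rewrite ffunE uc eqxx (leq_trans (zc cD)) ?leq_addr.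
  - rewrite !inE => /orP[/eqP->|]; last exact: zD'.
    by rewrite ffunE (negPf vNu) eqxx.
  exists s0 => //; apply: leq_trans le_s0 _; rewrite leq_add2l cardsU1 live_notin//.
  rewrite -addnA addnCA leq_add2l.
  rewrite [leqRHS](cardsD1 v) inE -uc uv v0 leq_add2l.
  apply/subset_leq_card/fintype.subsetP => x; rewrite !inE !ffunE => /andP[ux].
  rewrite ux; case: eqVneq => [xu|_]; last by case: eqVneq.
  by move: ux; rewrite xu adj_irrefl.
have [vc|vc] := eqVneq v c.
  rewrite -{}vc {c uc} in zE zc *; have vD := live_notin _ v0.
  have uD := live_notin _ u0; have zu := zE _ uD; rewrite eq_sym vNu in zu.
  have {zu} zu : z0 u = z u by exact: zu.
  (* If [v], the former [c], is already empty in the replay, there is nothing to move; otherwise [u]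
     acquires it. Formula [z1E] covers both cases. *)
  pose z1 := if 0 < z0 v then acquire z0 u v else z0.
  have z1E x : z1 x = if x == u then z0 u + z0 v else if x == v then 0 else z0 x.
    rewrite /z1; case: posnP => [zv0|_]; last by rewrite ffunE.
    by case: eqVneq => [->|_]; [rewrite zv0 addn0|case: eqVneq => [->|]].
  have [||x|s0 z1s0 le_s0] := IHs _ z1 u D zs.
  - move=> x xD xu; rewrite z1E ffunE (negPf xu).
    by case: eqVneq => // xv; exact: zE.
  - by move=> _; rewrite z1E ffunE eqxx zu leq_add2l zc.
  - exact: zD'.
  exists (if 0 < z0 v then z1 :: s0 else s0).
    rewrite /z1 in z1s0 *; case: ifP z1s0 => //= zv0 ->; rewrite andbT.
    apply/acq_moveP; exists u, v; split=> //; rewrite /can_acquire uv zv0 zu.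
    exact: leq_trans (zc vD) vu.
  have -> : last z0 (if 0 < z0 v then z1 :: s0 else s0) = last z1 s0.
    by rewrite /z1; case: (0 < z0 v).
  apply: leq_trans le_s0 _; rewrite !leq_add2l.
  (* The old count is at least 1, because [u] was a live neighbour of [v]. The new one is at most 1,
     because [u] has degree at most 2 and its neighbour [v] is now dead. *)
  have /card_gt0P : exists x, x \in live_nbrs z v.
    by exists u; rewrite inE adj_sym uv.
  apply: leq_trans; rewrite -(leq_add2l 1); apply: leq_trans (deg2 u).
  rewrite [leqRHS](cardsD1 v) inE uv leq_add2l.
  apply/subset_leq_card/fintype.subsetP => x; rewrite !inE ffunE => /andP[-> ].
  rewrite andbT; case: (eqVneq x u) => [->|_]; first by rewrite eq_sym vNu.
  by case: eqVneq.
(* The move avoids [c], and live vertices lie outside [D], so the same move is legal in the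
   replay. *)
have zu : z0 u = z u by rewrite zE// live_notin.
have zv : z0 v = z v by rewrite zE// live_notin.
have [||x|s0 z0s0 le_s0] := IHs _ (acquire z0 u v) c D zs.
- by move=> x xD xc; rewrite !ffunE zu zv zE.
- by move=> cD; rewrite !ffunE ![c == _]eq_sym (negPf uc) (negPf vc); exact: zc.
- exact: zD'.
exists (acquire z0 u v :: s0) => /=.
  by rewrite z0s0 andbT; apply/acq_moveP; exists u, v; rewrite /can_acquire uv zu zv v0.
apply: leq_trans le_s0 _; rewrite !leq_add2l.
apply/subset_leq_card/fintype.subsetP => x; rewrite !inE ffunE => /andP[->].
by case: eqVneq => [->|_]; last by case: eqVneq.
Qed.

Lemma total_acquisition_replay w w' c D :
  (forall x, x \notin D -> x != c -> w' x = w x) ->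
  (c \notin D -> w' c <= w c) -> (forall x, x \in D -> w x = 0) ->
  total_acquisition w' <= total_acquisition w + (#|D| + 2).
Proof.
move=> w'E w'c wD; have [s [/andP[ws _] <-]] := total_acquisition_attained w.
have [s0 w's0 le_s0] := acq_replay ws w'E w'c wD.
apply: leq_trans (total_acquisition_le_path w's0) (leq_trans le_s0 _).
rewrite !leq_add2l; apply: leq_trans (deg2 c); apply: subset_leq_card.
by apply/fintype.subsetP => x; rewrite !inE => /andP[].
Qed.

(** The change is split by emptying [c] first. Passing from [w] to [w0] lowers the weight of [c] and
    costs 2 with [D] empty; refilling [c] costs [1 + 2] with [D] the singleton of [c]. *)
Lemma total_acquisition_lipschitz w w' c : (forall x, x != c -> w' x = w x) ->
  total_acquisition w' <= total_acquisition w + 5.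
Proof.
move=> w'E; pose w0 : {ffun G -> nat} := [ffun x => if x == c then 0 else w x].
apply: leq_trans (@total_acquisition_replay w0 w' c [set c] _ _ _) _.
- by move=> x _ xc; rewrite w'E// ffunE (negPf xc).
- by rewrite inE eqxx.
- by move=> x; rewrite inE ffunE => ->.
rewrite cards1 -[5]/(2 + (1 + 2)) [leqRHS]addnA leq_add2r.
have := @total_acquisition_replay w w0 c finset.set0; rewrite cards0; apply.
- by move=> x _ /negPf xc; rewrite ffunE xc.
- by move=> _; rewrite ffunE eqxx.
- by move=> x; rewrite inE.
Qed.

End AcquisitionMoves.

Lemma card_path_nbrs (n : nat) (u : path_graph n) :
  (#|[set v : path_graph n | adj u v]%SET| <= 2)%N.
Proof.
pose P (v : 'I_n) := [set x : 'I_n | (x : nat) == v.+1]%SET.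
pose Q (v : 'I_n) := [set x : 'I_n | (x : nat).+1 == v]%SET.
rewrite (_ : [set v | _]%SET = P u :|: Q u); last first.
  by apply/setP => v; rewrite !inE /= /path_adj (eq_sym u.+1).
apply: leq_trans (leq_card_setU _ _) _; rewrite -[2%N]/(1 + 1)%N; apply: leq_add.
  apply/card_le1_eqP => x y; rewrite !inE => /eqP xu /eqP yu.
  by apply/val_inj; rewrite /= xu.
apply/card_le1_eqP => x y; rewrite !inE => /eqP xu /eqP yu; apply/val_inj.
by apply: succn_inj; rewrite xu yu.
Qed.

(** * Concentration of Lipschitz functions of independent variables *)

Lemma sqr_bounds (R : realDomainType) (r B : R) : 0 <= r <= B -> 0 <= r ^+ 2 <= B ^+ 2.
Proof.
move=> /andP[r0 rB]; rewrite sqr_ge0/= ler_sqr ?nnegrE//.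
exact: le_trans rB.
Qed.

Section IndependentCoordinates.
Context {R : realType} {d : measure_display} {T : measurableType d}.
Variables (P : probability T R) (I : finType) (X : I -> {RV P >-> nat}).

Definition joint (t : T) : {ffun I -> nat} := [ffun i => X i t].

Definition upd (x : {ffun I -> nat}) (i : I) (j : nat) : {ffun I -> nat} :=
  [ffun k => if k == i then j else x k].

Lemma upd_id x i : upd x i (x i) = x.
Proof. by apply/ffunP => k; rewrite ffunE; case: eqP => [->|]. Qed.

Lemma upd_upd x i j j' : upd (upd x i j) i j' = upd x i j'.
Proof. by apply/ffunP => k; rewrite !ffunE; case: eqP. Qed.

Lemma upd_comm x i k j j' : i != k ->
  upd (upd x k j) i j' = upd (upd x i j') k j.
Proof.
move=> ik; apply/ffunP => l; rewrite !ffunE.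
by case: eqP => [->|//]; rewrite (negPf ik).
Qed.

(** There are only countably many tuples, so any preimage is a countable union of preimages of
    points, each a finite intersection of coordinate events. *)
Lemma measurable_joint (A : set {ffun I -> nat}) : measurable (joint @^-1` A).
Proof.
rewrite -[A]setIid (_ : _ @^-1` _ =
    \bigcup_x (if x \in A then joint @^-1` [set x] else set0)); last first.
  apply/seteqP; split=> t /=.
    by move=> [At _]; exists (joint t) => //; rewrite mem_set.
  by move=> [x _]; case: ifPn => // /set_mem Ax /= ->.
apply: countable_bigcupT_measurable => // x; case: ifP => // _.
rewrite (_ : _ @^-1` _ = \bigcap_(i in setT) (X i @^-1` [set x i])); last first.
  apply/seteqP; split=> t /=; first by move=> <- i _ /=; rewrite ffunE.
  by move=> h; apply/ffunP => i; rewrite ffunE; apply: h.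
apply: fin_bigcap_measurable => // i _.
by rewrite -[_ @^-1` _]setTI; exact: measurable_funP.
Qed.

Lemma measurable_comp_joint d' (T' : measurableType d')
  (g : {ffun I -> nat} -> T') D : measurable_fun D (g \o joint).
Proof.
apply: measurable_funTS => _ Y _; rewrite setTI comp_preimage.
exact: measurable_joint.
Qed.

Lemma measurable_comp_coordinate d' (T' : measurableType d') i (g : nat -> T') D :
  measurable_fun D (fun t => g (X i t)).
Proof.
apply: measurable_funTS => _ Y _; rewrite setTI -[_ @^-1` _]setTI.
exact: (@measurable_funP _ _ _ _ setT (X i) measurableT (g @^-1` Y)).
Qed.

Lemma ge0_integral_nat_partition (Z : T -> nat) (D : set T) (f : T -> \bar R) :
  (forall k, measurable (Z @^-1` [set k])) -> measurable D ->
  measurable_fun D f -> (forall t, 0 <= f t)%E ->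
  (\int[P]_(t in D) f t =
   \sum_(0 <= k <oo) \int[P]_(t in D `&` Z @^-1` [set k]) f t)%E.
Proof.
move=> mZ mD mf f0.
have DE : D = \bigcup_k (D `&` Z @^-1` [set k]).
  by apply/seteqP; split=> [t Dt|t [k _ []//]]; exists (Z t).
rewrite {1}DE ge0_integral_bigcup//.
- by move=> k; exact: measurableI.
- by rewrite -DE.
- apply/trivIsetP => a b _ _ /eqP ab; apply/seteqP; split=> t //= [[_ Za] [_ Zb]].
  by apply: ab; rewrite -Za -Zb.
Qed.

(** * Resampling one independent coordinate *)

Hypothesis X_indep : mutually_independent X.

(** Zeroing entry [i] records the remaining coordinates in a tuple of the same type. Mutual
    independence over all of [I] and over the complement of [i] gives two products that differ by
    the factor at [i]. *)
Lemma indep_coordinate i j (x : {ffun I -> nat}) :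
  P (X i @^-1` [set j] `&` [set t | upd (joint t) i 0 = x]) =
  (P (X i @^-1` [set j]) * P [set t | upd (joint t) i 0 = x])%E.
Proof.
(* Entry [i] is overwritten by 0, so the event is empty unless [x i] is 0. *)
have [xi|xi] := eqVneq (x i) 0%N; last first.
  rewrite (_ : [set t | _] = set0) ?setI0 ?measure0 ?mule0//.
  apply/seteqP; split=> // t /= xE; move: xi; rewrite -xE ffunE eqxx.
  by rewrite eqxx.
have mB (j' : nat) k : measurable [set upd x i j' k] by [].
have setE (J : {set I}) j' :
    \bigcap_(k in [set` J]) X k @^-1` [set upd x i j' k] =
    [set t | forall k, k \in J -> X k t = upd x i j' k].
  by apply/seteqP; split.
have := X_indep [set~ i]%SET (mB 0%N); rewrite setE.
rewrite (_ : [set t | _] = [set t | upd (joint t) i 0 = x]); last first.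
  apply/seteqP; split=> t /=.
    move=> h; apply/ffunP => k; rewrite !ffunE; case: eqP => [->//|/eqP ki].
    by rewrite h ?inE// ffunE (negPf ki).
  by move=> <- k; rewrite !inE => /negPf ki; rewrite !ffunE ki.
move=> ->.
have := X_indep [set: I]%SET (mB j); rewrite setE.
rewrite (_ : [set t | _] =
    X i @^-1` [set j] `&` [set t | upd (joint t) i 0 = x]); last first.
  apply/seteqP; split=> t /=.
    move=> h; split; first by rewrite h ?inE// ffunE eqxx.
    apply/ffunP => k; rewrite !ffunE; case: eqP => [->//|/eqP ki].
    by rewrite h ?inE// ffunE (negPf ki).
  by move=> [Xi <-] k _; rewrite !ffunE; case: eqP => [->|].
move=> ->; rewrite (bigD1 i) ?inE//= ffunE eqxx; congr (_ * _)%E.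
apply: eq_big => k; rewrite !inE//= => /negPf ki.
by rewrite !ffunE ki.
Qed.

(** Since [h] ignores coordinate [i], it is constant on each cell of the countable partition by the
    other coordinates, and [indep_coordinate] applies cell by cell. *)
Lemma ge0_integral_indep i j (h : {ffun I -> nat} -> \bar R) :
  (forall x, 0 <= h x)%E -> (forall x, h (upd x i 0) = h x) ->
  (\int[P]_(t in X i @^-1` [set j]) h (joint t) =
   P (X i @^-1` [set j]) * \int[P]_t h (joint t))%E.
Proof.
move=> h0 hi; pose Z t := pickle (upd (joint t) i 0).
have mZ k : measurable (Z @^-1` [set k]).
  exact: (measurable_joint [set x | pickle (upd x i 0) = k]).
have mXi : measurable (X i @^-1` [set j]).
  by rewrite -[_ @^-1` _]setTI; exact: measurable_funP.
have mh D : measurable_fun D (fun t => h (joint t)).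
  exact: measurable_comp_joint.
rewrite (ge0_integral_nat_partition mZ mXi)//.
rewrite (ge0_integral_nat_partition mZ measurableT)//.
have pE : P (X i @^-1` [set j]) = (fine (P (X i @^-1` [set j])))%:E.
  by rewrite fineK ?fin_num_measure.
rewrite pE -nneseriesZl; last by move=> k _; exact: integral_ge0.
apply: eq_eseriesr => k _; rewrite setTI.
(* A number that codes no tuple indexes an empty cell. *)
case kE : (@pickle_inv {ffun I -> nat} k) => [x|]; last first.
  rewrite (_ : Z @^-1` _ = set0) ?setI0 ?integral_set0 ?mule0//.
  by apply/seteqP; split=> // t /= Zk; move: kE; rewrite -Zk pickleK_inv.
have -> : Z @^-1` [set k] = [set t | upd (joint t) i 0 = x].
  apply/seteqP; split=> t /= Zt; first by move: kE; rewrite -Zt pickleK_inv => -[].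
  by have := @pickle_invK {ffun I -> nat} k; rewrite kE /= => <-; rewrite -Zt.
have mx : measurable [set t | upd (joint t) i 0 = x].
  exact: (measurable_joint [set y | upd y i 0 = x]).
have hx D : measurable D ->
    (\int[P]_(t in D `&` [set t | upd (joint t) i 0 = x]) h (joint t) =
    h x * P (D `&` [set t | upd (joint t) i 0 = x]))%E.
  move=> mD; rewrite -integral_cst; last exact: measurableI.
  by apply: eq_integral => t /set_mem[_ /= <-]; rewrite hi.
rewrite hx// -[X in (_ * \int[_]_(_ in X) _)%E]setTI hx// setTI indep_coordinate pE.
by rewrite muleCA.
Qed.

(** A Fubini identity without a product space: the second integration over [T] supplies an
    independent copy of coordinate [i]. Both sides are split along the value [j] of that
    coordinate. *)
Lemma ge0_integral_resample i (h : {ffun I -> nat} -> \bar R) :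
  (forall x, 0 <= h x)%E ->
  (\int[P]_t h (joint t) = \int[P]_s \int[P]_t h (upd (joint s) i (X i t)))%E.
Proof.
move=> h0.
have mXi k : measurable (X i @^-1` [set k]).
  by rewrite -[_ @^-1` _]setTI; exact: measurable_funP.
rewrite (ge0_integral_nat_partition mXi measurableT)//; last first.
  exact: measurable_comp_joint.
transitivity (\int[P]_s
    \sum_(0 <= j <oo) P (X i @^-1` [set j]) * h (upd (joint s) i j))%E.
  rewrite integral_nneseries//; last 2 first.
  - move=> j.
    exact: (measurable_comp_joint (fun x => (P (X i @^-1` [set j]) * h (upd x i j))%E)).
  - by move=> j s _; rewrite mule_ge0.
  apply: eq_eseriesr => j _; rewrite setTI.
  have -> : (\int[P]_(t in X i @^-1` [set j]) h (joint t) =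
      \int[P]_(t in X i @^-1` [set j]) h (upd (joint t) i j))%E.
    apply: eq_integral => t /set_mem /= Xij.
    by rewrite -[in LHS](upd_id (joint t) i) ffunE Xij.
  rewrite (@ge0_integral_indep i j (fun x => h (upd x i j)))//; last first.
    by move=> x; rewrite upd_upd.
  have pE : P (X i @^-1` [set j]) = (fine (P (X i @^-1` [set j])))%:E.
    by rewrite fineK ?fin_num_measure.
  rewrite pE ge0_integralZl//.
  - exact: (measurable_comp_joint (fun x => h (upd x i j))).
  - by rewrite lee_fin fine_ge0.
apply: eq_integral => s _.
rewrite (ge0_integral_nat_partition mXi measurableT)//; last first.
  exact: (measurable_comp_coordinate i (fun j => h (upd (joint s) i j))).
apply: eq_eseriesr => j _; rewrite setTI muleC -integral_cst//.
by apply: eq_integral => t /set_mem /= ->.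
Qed.

(** * Integrals of bounded functions and a second-moment estimate *)

Lemma integrable_cst_EFin (r : R) : P.-integrable setT (EFin \o (fun=> r)).
Proof. exact: finite_measure_integrable_cst. Qed.

Lemma integrableZl_EFin (k : R) (h : T -> R) :
  P.-integrable setT (EFin \o h) ->
  P.-integrable setT (EFin \o (fun t => k * h t)).
Proof. by move=> ih; exact: (integrableZl measurableT k ih). Qed.

Lemma integrableD_EFin (h1 h2 : T -> R) :
  P.-integrable setT (EFin \o h1) -> P.-integrable setT (EFin \o h2) ->
  P.-integrable setT (EFin \o (fun t => h1 t + h2 t)).
Proof. by move=> i1 i2; exact: (integrableD measurableT i1 i2). Qed.

Lemma bounded_ge0_integrable (h : T -> R) (B : R) :
  measurable_fun setT h -> (forall t, 0 <= h t <= B) ->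
  P.-integrable setT (EFin \o h).
Proof.
move=> mh hB; apply: measurable_bounded_integrable => //.
  by rewrite (le_lt_trans (probability_le1 _ _))// ltry.
exists B; split; rewrite ?num_real// => M BM t _ /=.
by have /andP[h0 hB'] := hB t; rewrite ger0_norm// (le_trans hB')// ltW.
Qed.

Lemma Rintegral_probability_cst (r : R) : \int[P]_t r = r.
Proof. by rewrite Rintegral_cst//= probability_setT mulr1. Qed.

Lemma Rintegral_bounds (h : T -> R) (B : R) :
  measurable_fun setT h -> (forall t, 0 <= h t <= B) -> 0 <= \int[P]_t h t <= B.
Proof.
move=> mh hB; rewrite Rintegral_ge0/=; last by move=> t _; case/andP: (hB t).
rewrite -[leRHS]Rintegral_probability_cst; apply: le_Rintegral => //.
- exact: bounded_ge0_integrable hB.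
- exact: integrable_cst_EFin.
- by move=> t _; case/andP: (hB t).
Qed.

(* With m the mean of h, |h - m| <= c pointwise, i.e. h^2 + m^2 <= 2 m h + c^2. *)
Lemma second_moment_osc (h : T -> R) (B c : R) :
  measurable_fun setT h -> (forall t, 0 <= h t <= B) ->
  (forall s t, h s <= h t + c) ->
  \int[P]_t (h t ^+ 2) <= (\int[P]_t h t) ^+ 2 + c ^+ 2.
Proof.
move=> mh hB hc; set m := \int[P]_t h t.
have ih := bounded_ge0_integrable mh hB.
have icst := integrable_cst_EFin.
have mh2 : measurable_fun setT (fun t => h t ^+ 2) by exact: measurable_funX.
have hB2 t : 0 <= h t ^+ 2 <= B ^+ 2 by exact: sqr_bounds.
have ih2 := bounded_ge0_integrable mh2 hB2.
(* The two sides come from averaging [h s <= h t + c] over [s] and over [t]. *)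
have hm s : `|h s - m| <= c.
  rewrite ler_norml lerBrDr lerBlDr [- c + _]addrC lerBlDr; apply/andP; split.
    rewrite -[leRHS]Rintegral_probability_cst; apply: le_Rintegral => //.
  rewrite addrC -[c in leRHS]Rintegral_probability_cst -RintegralD//.
  rewrite -[leLHS]Rintegral_probability_cst; apply: le_Rintegral => //.
  exact: integrableD_EFin.
rewrite -(lerD2r (m ^+ 2)) -{1}[m ^+ 2]Rintegral_probability_cst -RintegralD//.
have -> : m ^+ 2 + c ^+ 2 + m ^+ 2 = \int[P]_t ((2 * m) * h t + c ^+ 2).
  rewrite RintegralD//; last exact: integrableZl_EFin.
  by rewrite RintegralZl// Rintegral_probability_cst -/m; ring.
apply: le_Rintegral => //.
- exact: integrableD_EFin.
- by apply: integrableD_EFin => //; exact: integrableZl_EFin.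
- move=> t _; rewrite -subr_ge0.
  rewrite (_ : _ - _ = c ^+ 2 - `|h t - m| ^+ 2); last first.
    by rewrite real_normK ?num_real//; ring.
  by rewrite subr_ge0 ler_sqr ?nnegrE// (le_trans _ (hm t)).
Qed.

(** Under independence this is the conditional expectation of [g] given all coordinates but [i],
    kept as a function of tuples so that it can be iterated. *)
Definition avg (i : I) (g : {ffun I -> nat} -> R) (x : {ffun I -> nat}) : R :=
  \int[P]_t g (upd x i (X i t)).

Lemma measurable_avg i (g : {ffun I -> nat} -> R) x :
  measurable_fun setT (fun t => g (upd x i (X i t))).
Proof. exact: (measurable_comp_coordinate i (fun j => g (upd x i j))). Qed.

Lemma avg_bounds i (g : {ffun I -> nat} -> R) B x :
  (forall x, 0 <= g x <= B) -> 0 <= avg i g x <= B.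
Proof. by move=> gB; apply: Rintegral_bounds => //; exact: measurable_avg. Qed.

Lemma avg_upd_same i (g : {ffun I -> nat} -> R) x j :
  avg i g (upd x i j) = avg i g x.
Proof. by apply: eq_Rintegral => t _; rewrite upd_upd. Qed.

Lemma avg_upd_invariant i k (g : {ffun I -> nat} -> R) x j :
  (forall x j, g (upd x k j) = g x) -> avg i g (upd x k j) = avg i g x.
Proof.
move=> gk; have [->|ik] := eqVneq k i; first exact: avg_upd_same.
by apply: eq_Rintegral => t _; rewrite upd_comm 1?eq_sym// gk.
Qed.

Lemma avg_lipschitz i k (g : {ffun I -> nat} -> R) B c x j :
  0 <= c -> (forall x, 0 <= g x <= B) ->
  (forall x j, g x <= g (upd x k j) + c) ->
  avg i g x <= avg i g (upd x k j) + c.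
Proof.
move=> c0 gB gc; have [->|ik] := eqVneq k i; first by rewrite avg_upd_same lerDl.
have ig y : P.-integrable setT (EFin \o (fun t => g (upd y i (X i t)))).
  by apply: (@bounded_ge0_integrable _ B) => //; exact: measurable_avg.
have ic : P.-integrable setT (EFin \o (fun=> c)).
  exact: integrable_cst_EFin.
rewrite -[X in _ + X]Rintegral_probability_cst -RintegralD//.
apply: le_Rintegral => //; first exact: integrableD_EFin.
by move=> t _; rewrite upd_comm 1?eq_sym.
Qed.

Lemma Rintegral_resample i (g : {ffun I -> nat} -> R) B :
  (forall x, 0 <= g x <= B) ->
  \int[P]_t g (joint t) = \int[P]_t avg i g (joint t).
Proof.
move=> gB; congr fine.
rewrite (@ge0_integral_resample i (fun x => (g x)%:E)); last first.
  by move=> x; rewrite lee_fin; case/andP: (gB x).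
apply: eq_integral => s _; rewrite fineK//.
apply: integrable_fin_num => //.
by apply: (@bounded_ge0_integrable _ B) => //; exact: measurable_avg.
Qed.

Lemma second_moment_resample i (g : {ffun I -> nat} -> R) B c :
  (forall x, 0 <= g x <= B) -> (forall x j, g x <= g (upd x i j) + c) ->
  \int[P]_t (g (joint t) ^+ 2) <= \int[P]_t (avg i g (joint t) ^+ 2) + c ^+ 2.
Proof.
move=> gB gc; rewrite (@Rintegral_resample i (fun x => g x ^+ 2) (B ^+ 2)); last first.
  by move=> x; exact: sqr_bounds.
have ic : P.-integrable setT (EFin \o (fun=> c ^+ 2)).
  exact: integrable_cst_EFin.
have ia : P.-integrable setT (EFin \o (fun t => avg i g (joint t) ^+ 2)).
  apply: (@bounded_ge0_integrable _ (B ^+ 2)).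
    exact: (measurable_comp_joint (fun x => avg i g x ^+ 2)).
  by move=> t; apply: sqr_bounds; exact: avg_bounds.
rewrite -[X in _ + X]Rintegral_probability_cst -RintegralD//.
apply: le_Rintegral => //.
- apply: (@bounded_ge0_integrable _ (B ^+ 2)).
    exact: (measurable_comp_joint (fun x => avg i (fun x => g x ^+ 2) x)).
  by move=> t; apply: avg_bounds => x; exact: sqr_bounds.
- exact: integrableD_EFin.
- move=> s _; apply: (@second_moment_osc _ B) => //; first exact: measurable_avg.
  by move=> t t'; rewrite -(upd_upd (joint s) i (X i t) (X i t')).
Qed.

(** Averaging out the coordinates of [s] in turn preserves the mean, the bounds, the oscillation
    constant and the invariances already gained; each step costs [c ^+ 2]. *)
Lemma second_moment_resample_seq (s : seq I) (g : {ffun I -> nat} -> R) B c :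
  0 <= c -> (forall x, 0 <= g x <= B) ->
  (forall k x j, g x <= g (upd x k j) + c) ->
  exists g', [/\ (forall x, 0 <= g' x <= B),
    (forall k x j, g' x <= g' (upd x k j) + c),
    (forall k, k \in s -> forall x j, g' (upd x k j) = g' x),
    \int[P]_t g (joint t) = \int[P]_t g' (joint t) &
    \int[P]_t (g (joint t) ^+ 2) <=
      \int[P]_t (g' (joint t) ^+ 2) + (size s)%:R * c ^+ 2].
Proof.
move=> c0 gB gc; elim: s => [|i s [g1 [g1B g1c g1s g1E g1E2]]].
  by exists g; split=> //; rewrite mul0r addr0.
exists (avg i g1); split.
- by move=> x; exact: avg_bounds.
- by move=> k x j; apply: avg_lipschitz => //; exact: g1B.
- move=> k; rewrite inE => /predU1P[->|ks] x j; first exact: avg_upd_same.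
  by apply: avg_upd_invariant; exact: g1s.
- by rewrite g1E (Rintegral_resample i g1B).
- apply: (le_trans g1E2); rewrite /= -[X in _ <= _ + X * _]natr1 mulrDl mul1r.
  rewrite [X in _ <= _ + X]addrC addrA lerD2r.
  by apply: second_moment_resample => //; exact: g1B.
Qed.

(** As [I] is finite, any tuple becomes any other by finitely many one-coordinate updates. *)
Lemma upd_invariant_cst (g : {ffun I -> nat} -> R) :
  (forall k x j, g (upd x k j) = g x) -> forall x y, g x = g y.
Proof.
move=> gk x y; pose z s := foldr (fun k u => upd u k (y k)) x s.
have gz s : g (z s) = g x by elim: s => //= k s <-; rewrite gk.
have zE s k : k \in s -> z s k = y k.
  elim: s => //= a s IHs; rewrite inE ffunE.
  by case: eqP => [->//|_] /=; exact: IHs.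
rewrite -(gz (enum I)); congr g; apply/ffunP => k.
by rewrite zE// mem_enum.
Qed.

(** Once all coordinates are averaged out, [g'] is constant, equal to the mean [m], so the second
    moment of [g] exceeds [m ^+ 2] by at most [c ^+ 2] per coordinate. *)
Lemma variance_bound (g : {ffun I -> nat} -> R) B c :
  0 <= c -> (forall x, 0 <= g x <= B) ->
  (forall k x j, g x <= g (upd x k j) + c) ->
  \int[P]_t ((g (joint t) - \int[P]_s g (joint s)) ^+ 2) <= #|I|%:R * c ^+ 2.
Proof.
move=> c0 gB gc.
have [g' [g'B _ g'E gE gE2]] := second_moment_resample_seq (enum I) c0 gB gc.
have g'cst := upd_invariant_cst (fun k x j => g'E k (mem_enum _ k) x j).
rewrite gE; pose m := g' [ffun=> 0%N].
have g'm x : g' x = m by exact: g'cst.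
have E1 : \int[P]_t g' (joint t) = m.
  by rewrite -[RHS]Rintegral_probability_cst; apply: eq_Rintegral => t _.
have E2 : \int[P]_t (g' (joint t) ^+ 2) = m ^+ 2.
  by rewrite -[RHS]Rintegral_probability_cst; apply: eq_Rintegral => t _; rewrite g'm.
rewrite {}E1 in gE *; rewrite {}E2 -cardE in gE2.
have icst := integrable_cst_EFin.
have ig : P.-integrable setT (EFin \o (fun t => g (joint t))).
  apply: (@bounded_ge0_integrable _ B) => //; exact: (measurable_comp_joint g).
have ig2 : P.-integrable setT (EFin \o (fun t => g (joint t) ^+ 2)).
  apply: (@bounded_ge0_integrable _ (B ^+ 2)).
    exact: (measurable_comp_joint (fun x => g x ^+ 2)).
  by move=> t; exact: sqr_bounds.
have iZ : P.-integrable setT (EFin \o (fun t => (- (2 * m)) * g (joint t))).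
  exact: integrableZl_EFin.
have iD : P.-integrable setT (EFin \o (fun t => (- (2 * m)) * g (joint t) + m ^+ 2)).
  exact: integrableD_EFin.
have -> : \int[P]_t ((g (joint t) - m) ^+ 2) =
    \int[P]_t (g (joint t) ^+ 2 + ((- (2 * m)) * g (joint t) + m ^+ 2)).
  by apply: eq_Rintegral => t _; ring.
rewrite RintegralD// RintegralD// RintegralZl// gE Rintegral_probability_cst.
by move: gE2; set e := #|I|%:R * _; lra.
Qed.

(** Chebyshev's inequality: on the tail event the squared deviation is at least [r ^+ 2]. *)
Lemma tail_bound (g : {ffun I -> nat} -> R) B c r :
  0 <= c -> (forall x, 0 <= g x <= B) ->
  (forall k x j, g x <= g (upd x k j) + c) -> 0 < r ->
  (P [set t | (r < `|g (joint t) - \int[P]_s g (joint s)|)%R] <=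
    (#|I|%:R * c ^+ 2 / r ^+ 2)%:E)%E.
Proof.
move=> c0 gB gc r0; set m := \int[P]_s g (joint s).
have mA : measurable [set t | r < `|g (joint t) - m|].
  exact: (measurable_joint [set x | r < `|g x - m|]).
have mg2 D : measurable_fun D (fun t => ((g (joint t) - m) ^+ 2)%:E).
  exact: (measurable_comp_joint (fun x => ((g x - m) ^+ 2)%:E)).
have m0 : 0 <= m <= B.
  by apply: Rintegral_bounds => //; exact: (measurable_comp_joint g).
rewrite EFinM lee_pdivlMr ?exprn_gt0// muleC -integral_cst//.
apply: (@le_trans _ _ (\int[P]_t ((g (joint t) - m) ^+ 2)%:E)%E).
  apply: (@le_trans _ _ (\int[P]_(t in [set t | (r < `|g (joint t) - m|)%R])
      ((g (joint t) - m) ^+ 2)%:E)%E).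
    apply: ge0_le_integral => //.
    - by move=> t _; rewrite lee_fin/= sqr_ge0.
    - move=> t /= /ltW rt; rewrite lee_fin -[leRHS]real_normK ?num_real//.
      by rewrite ler_sqr ?nnegrE// ltW.
  apply: ge0_subset_integral => //.
  by move=> t _; rewrite lee_fin sqr_ge0.
rewrite -[leLHS]fineK.
  by rewrite lee_fin; exact: (variance_bound c0 gB gc).
apply: integrable_fin_num => //.
apply: (@bounded_ge0_integrable (fun t => (g (joint t) - m) ^+ 2) (B ^+ 2)).
  exact: (measurable_comp_joint (fun x => (g x - m) ^+ 2)).
move=> t; rewrite sqr_ge0/= -[leLHS]real_normK ?num_real//.
have /andP[g0 g1] := gB (joint t); have /andP[m0' m1] := m0.
rewrite ler_sqr ?nnegrE//; last exact: le_trans g1.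
by rewrite ler_norml; apply/andP; split; lra.
Qed.

End IndependentCoordinates.

(** * Poisson weights *)

Section PoissonAcquisition.
Context {R : realType} {d : measure_display} {T : measurableType d}.
Variables (P : probability T R) (G : sgraph) (X : G -> {RV P >-> nat}).
Hypothesis deg2 : forall u : G, (#|[set v | adj u v]%SET| <= 2)%N.
Hypothesis X_indep : mutually_independent X.
Hypothesis X_poisson : forall i, poisson_distributed 1 (X i).

Let A (x : {ffun G -> nat}) : R := (total_acquisition x)%:R.

Lemma probability_isolated (u : G) :
  ((expR (- 1) ^+ 3)%:E <= P [set t | isolated (joint X t) u])%E.
Proof.
have mI (B : set {ffun G -> nat}) := measurable_joint X B.
pose J := [set v | (v == u) || adj u v]%SET.
pose B (v : G) : set nat := [set nat_of_bool (v == u)].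
apply: (@le_trans _ _ (P (\bigcap_(v in [set` J]) X v @^-1` B v))); last first.
  apply: le_measure; rewrite ?in_setE//.
  - apply: fin_bigcap_measurable => // v _.
    by rewrite -[_ @^-1` _]setTI; exact: measurable_funP.
  - exact: (mI [set x | isolated x u]).
  - move=> t h; have XE v : v \in J -> X v t = (v == u) by exact: h.
    rewrite /= /isolated ffunE XE ?inE eqxx//=.
    apply/forallP => v; apply/implyP => uv; rewrite ffunE XE ?inE ?uv ?orbT//.
    by rewrite eqb0; apply: contraTneq uv => ->; rewrite adj_irrefl.
(* A Poisson variable of rate 1 takes the values 0 and 1 with the same probability [expR (- 1)], so
   all factors agree; there are at most three, the vertex and its neighbours. *)
rewrite X_indep// (eq_bigr (fun=> (expR (- 1))%:E)); last first.
  move=> v _; rewrite X_poisson /poisson_pmf ltr01.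
  by case: eqP => _ /=; rewrite ?expr1 ?expr0 ?fact0 invr1 !mul1r.
rewrite prodEFin lee_fin prodr_const; apply: ler_wiXn2l.
- exact: expR_ge0.
- by rewrite -[leRHS]expR0 ler_expR lerN10.
rewrite (_ : J = u |: [set v | adj u v])%SET; last by apply/setP => v; rewrite !inE.
by rewrite cardsU1 -[3%N]/(1 + 2)%N leq_add// leq_b1.
Qed.

Let A_bounds x : 0 <= A x <= #|G|%:R.
Proof. by rewrite /A ler0n ler_nat total_acquisition_le_card. Qed.

Let measurable_A : measurable_fun setT (fun t => A (joint X t)).
Proof. exact: (measurable_comp_joint X A). Qed.

(** The number of isolated vertices is a sum of indicators, so linearity of the integral reduces the
    bound to [probability_isolated]. *)
Lemma mean_total_acquisition_ge :
  #|G|%:R * expR (- 1) ^+ 3 <= \int[P]_t A (joint X t).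
Proof.
have mI u : measurable [set t | isolated (joint X t) u].
  exact: (measurable_joint X [set x | isolated x u]).
rewrite -lee_fin /Rintegral fineK; last first.
  by apply: integrable_fin_num => //; apply: bounded_ge0_integrable.
apply: (@le_trans _ _
  (\int[P]_t (\sum_(u : G) (\1_[set t | isolated (joint X t) u] t)%:E)%E)%E); last first.
  apply: ge0_le_integral => //.
  - by move=> t _; apply: sume_ge0 => u _; rewrite lee_fin.
  - apply: emeasurable_sum => u; apply/measurable_EFinP.
    exact: measurable_indic.
  - exact/measurable_EFinP.
  - move=> t _; rewrite sumEFin lee_fin.
    apply: le_trans (_ : #|[set u | isolated (joint X t) u]%SET|%:R <= _); last first.
      by rewrite ler_nat isolated_le_total_acquisition.
    rewrite -sum1_card natr_sum [leRHS]big_mkcond; apply: ler_sum => u _.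
    rewrite indicE; case: ifPn; rewrite finset.inE => uP; first by rewrite mem_set.
    by rewrite memNset//; exact/negP.
rewrite ge0_integral_sum//; last first.
  by move=> u; apply/measurable_EFinP; exact: measurable_indic.
rewrite mulr_natl -sumr_const -sumEFin; apply: lee_sum => u _.
rewrite integral_indic// setIT; exact: probability_isolated.
Qed.

Lemma mean_total_acquisition_le : \int[P]_t A (joint X t) <= #|G|%:R.
Proof.
by have /andP[] := Rintegral_bounds P measurable_A (fun t => A_bounds (joint X t)).
Qed.

Lemma total_acquisition_tail r : 0 < r ->
  (P [set t | (r < `|A (joint X t) - \int[P]_s A (joint X s)|)%R] <=
    (#|G|%:R * 5 ^+ 2 / r ^+ 2)%:E)%E.
Proof.
move=> r0; apply: (tail_bound X_indep _ A_bounds) => // k x j.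
rewrite /A -natrD ler_nat; apply: (total_acquisition_lipschitz deg2 (c := k)).
by move=> y /negPf yk; rewrite ffunE yk.
Qed.

End PoissonAcquisition.

(** * Specialization to the path, and the asymptotic statements *)

Section PathAcquisition.
Context {R : realType} {d : measure_display} {T : measurableType d}.
Variables (P : probability T R) (n : nat) (X : 'I_n -> {RV P >-> nat}).
Hypothesis X_indep : mutually_independent X.
Hypothesis X_poisson : forall i, poisson_distributed 1 (X i).

Let mean : R := fine 'E_P[path_acquisition X].

Let meanE : mean = \int[P]_t (total_acquisition
  (joint (X : path_graph n -> {RV P >-> nat}) t : {ffun path_graph n -> nat}))%:R.
Proof. by rewrite /mean unlock. Qed.

Lemma path_acquisition_mean_bounds : n%:R * expR (- 1) ^+ 3 <= mean <= n%:R.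
Proof.
have nE : #|path_graph n| = n by rewrite /= card_ord.
rewrite meanE -[X in X%:R * _]nE -[X in _ && (_ <= X%:R)]nE; apply/andP; split.
  exact: mean_total_acquisition_ge (@card_path_nbrs n) X_indep X_poisson.
exact: mean_total_acquisition_le.
Qed.

Lemma path_acquisition_tail r : 0 < r ->
  (P [set t | (r < `|path_acquisition X t - mean|)%R] <=
    (n%:R * 25 / r ^+ 2)%:E)%E.
Proof.
move=> r0; have nE : #|path_graph n| = n by rewrite /= card_ord.
have := @total_acquisition_tail _ _ _ P (path_graph n) X
  (@card_path_nbrs n) X_indep r r0.
by rewrite nE -meanE (_ : 5 ^+ 2 = 25 :> R)//; ring.
Qed.

Lemma measurable_path_acquisition_event (B : set R) :
  measurable [set t | B (path_acquisition X t)].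
Proof.
exact: (measurable_joint X [set x | B (total_acquisition
  (x : {ffun path_graph n -> nat}))%:R]).
Qed.

End PathAcquisition.

Theorem theorem3p5 (R : realType)
    (d : nat -> measure_display) (T : forall n, measurableType (d n))
    (P : forall n, probability (T n) R)
    (X : forall n, 'I_n -> {RV (P n) >-> nat})
    (X_indep : forall n, mutually_independent (@X n))
    (X_poisson : forall n (i : 'I_n), poisson_distributed 1 (X n i)) :
  let A n : T n -> R := path_acquisition (@X n) in
  let EA (n : nat) : R := fine 'E_(P n)[A n] in
  [/\ forall phi : nat -> R, phi n @[n --> \oo] --> +oo ->
        P n [set t | `|A n t - EA n| > Num.sqrt (2 * n%:R * phi n)]
          @[n --> \oo] --> 0%E,
      EA \is 'Theta_\oo (fun n => n%:R : R)
    & forall phi : nat -> R, phi n @[n --> \oo] --> +oo ->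
        exists width : nat -> R,
          width =O_\oo (fun n => Num.sqrt (n%:R * phi n)) /\
          P n [set t | A n t \in `[EA n - width n / 2, EA n + width n / 2]]
            @[n --> \oo] --> 1%E].
Proof.
move=> A EA.
have tail0 (phi : nat -> R) : phi n @[n --> \oo] --> +oo ->
    P n [set t | `|A n t - EA n| > Num.sqrt (2 * n%:R * phi n)] @[n --> \oo] --> 0%E.
  move=> phioo; have phi0 : \forall n \near \oo, 0 < phi n.
    by move/cvgryPgt : phioo; exact.
  (* For [r] the square root of [2 * n%:R * phi n], the tail bound [n%:R * 25 / r ^+ 2] simplifies
     to [25 / 2] over [phi n]. *)
  apply: (@squeeze_cvge _ _ _ _ (fun=> 0%E) _ (fun n => (25 / 2 * (phi n)^-1)%:E)).
  - near=> n; rewrite measure_ge0/=.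
    have n0 : 0 < n%:R :> R by rewrite ltr0n; near: n; exact: nbhs_infty_gt.
    have pn0 : 0 < phi n by near: n.
    have q0 : 0 < 2 * n%:R * phi n by rewrite !mulr_gt0.
    apply: le_trans (path_acquisition_tail (X_indep n) _) _; first by rewrite sqrtr_gt0.
    rewrite lee_fin sqr_sqrtr ?(ltW q0)// le_eqVlt; apply/orP; left; apply/eqP.
    by field; rewrite !gt_eqF.
  - exact: cvg_cst.
  - apply: cvg_EFin; first by near=> n.
    rewrite -[X in _ --> X](mulr0 (25 / 2)); apply: cvgMr.
    exact/(gtr0_cvgV0 phi0).
split => //.
(* The constants of the linear lower and upper bounds on the mean. *)
- apply/asboolP; exists (expR (- 1) ^+ 3, 1) => /=.
    by rewrite ltr01 andbT exprn_gt0// expR_gt0.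
  near=> n.
  have /andP[EA1 EA2] := path_acquisition_mean_bounds (X_indep n) (@X_poisson n).
  have EA0 : 0 <= EA n by apply: le_trans EA1; rewrite mulr_ge0// exprn_ge0// expR_ge0.
  by rewrite !ger0_norm// mul1r mulrC.
(* The half-width is exactly the deviation threshold of [tail0], so the interval event is the
   complement of the tail event; the factor [2 * Num.sqrt 2] is absorbed by the O. *)
- move=> phi phioo; exists (fun n => 2 * Num.sqrt (2 * n%:R * phi n)); split.
    apply/eqOP; near=> k; near=> n.
    rewrite -mulrA sqrtrM// mulrA normrM ler_wpM2r// ger0_norm ?mulr_ge0//.
  have := tail0 phi phioo; move=> /(cvgeB _ (cvg_cst 1%E)) => /(_ isT).
  rewrite sube0; apply: cvg_trans; apply: near_eq_cvg; near=> n.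
  rewrite /= -probability_setC; last first.
    exact: (measurable_path_acquisition_event (X n)
      [set a | Num.sqrt (2 * n%:R * phi n) < `|a - EA n|]).
  set r := Num.sqrt _; rewrite (_ : 2 * r / 2 = r); last by field.
  congr (P n _); apply/seteqP; split=> t /=; rewrite in_itv/=.
    by move=> /negP; rewrite -leNgt ler_distl.
  by move=> h; apply/negP; rewrite -leNgt ler_distl.
Unshelve. all: by end_near. Qed.
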